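(* Let $M$ be a fixed deterministic Turing machine and let $D$, $F$, $B_T$ be as defined in the context. Let $(p_n)_{n \in \mathbb{N}}$ be defined by $p_0 = \bot$ (the everywhere-undefined function) and $p_{n+1} = F(p_n)$, and let $p_\omega = \bigsqcup_{n \in \mathbb{N}} p_n$. Then $F$ has a least fixed point and $\operatorname{lfp}(F) = \bigsqcup_{n\in\mathbb{N}} p_n = p_\omega$; moreover $p_\omega \notin \bigcup_{T \in \mathbb{N}} B_T$.
   Context: Let $D$ be the set of partial functions $p : \mathbb{N} \to \{0,1,\bot\}$ (where $p(k)=\bot$ means $p$ is undefined at $k$) satisfying: $p(k) = 1$ implies $p(k') = 1$ for all $k' \ge k$, ordered by $p \sqsubseteq q$ iff $q(x) = p(x)$ whenever $p(x) \neq \bot$; $\bigsqcup$ denotes least upper bound in this order and $\operatorname{lfp}(F)$ the least fixed point of $F$ with respect to $\sqsubseteq$. Define $F : D \to D$ by: $F(p)(0) = 1$ if $M$ halts at or before step $0$, and $F(p)(0) = 0$ otherwise; and for $k \ge 0$, $F(p)(k+1) = \bot$ if $p(k) = \bot$; $F(p)(k+1) = 1$ if $p(k) = 1$; $F(p)(k+1) = 1$ if $p(k) = 0$ and $M$ halts at exactly step $k+1$; $F(p)(k+1) = 0$ if $p(k) = 0$ and $M$ does not halt at step $k+1$. For $T \in \mathbb{N}$, $B_T$ denotes the class of finite halting observations computable by a machine with time bound $T$, namely the partial functions defined on $\{0, 1, \ldots, T-1\}$ and undefined ($=\bot$) at every $k \ge T$.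
   Formalization: When M halts, F as defined does not map D into D (even some p_n leave D), so F is taken on all partial functions from N to {0,1}; the least upper bound and least fixed point are taken there, and p_ω is shown to lie in D. M runs on an arbitrary fixed input word. *)

(* Defs.v *)
From mathcomp Require Import all_boot all_order all_algebra.

Set Implicit Arguments.
Unset Strict Implicit.
Unset Printing Implicit Defensive.

Inductive direction := MoveLeft | MoveRight | Stay.

(* Deterministic single-tape machine; [delta q a = None] means that the machine
   halts when it reads [a] in state [q]. *)
Record turing_machine := TuringMachine {
  state : finType;
  symbol : finType;
  start : state;
  blank : symbol;
  delta : state -> symbol -> option (state * symbol * direction)
}.

Section Run.
Variable M : turing_machine.

(* The tape is two-way infinite, with cells indexed by [int]. *)
Record configuration := Configuration {
  cur : state M;
  head_pos : int;
  tape : int -> symbol M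
}.

Definition move (d : direction) (i : int) : int :=
  match d with
  | MoveLeft => (i - 1)%R
  | MoveRight => (i + 1)%R
  | Stay => i
  end.

Definition halted (c : configuration) : bool :=
  ~~ isSome (delta (cur c) (tape c (head_pos c))).

(* Halted configurations are left unchanged. *)
Definition step (c : configuration) : configuration :=
  match delta (cur c) (tape c (head_pos c)) with
  | None => c
  | Some (q, a, d) =>
      Configuration q (move d (head_pos c))
        (fun i => if i == head_pos c then a else tape c i)
  end.

(* The input word occupies cells 0, 1, ..., size w - 1; the head starts at 0. *)
Definition initial (w : seq (symbol M)) : configuration :=
  Configuration (start M) 0%R
    (fun i => match i with Posz n => nth (blank M) w n | Negz _ => blank M end).

Definition config_at (w : seq (symbol M)) (k : nat) : configuration :=
  iter k step (initial w).

Definition halts_at (w : seq (symbol M)) (k : nat) : bool :=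
  halted (config_at w k) && [forall j : 'I_k, ~~ halted (config_at w j)].

Definition halts_by (w : seq (symbol M)) (k : nat) : bool :=
  [exists j : 'I_k.+1, halts_at w j].

End Run.

(* Partial functions from nat to {0, 1}: [None] is the undefined value,
   [Some false] is 0 and [Some true] is 1. *)
Definition pfun := nat -> option bool.

Definition pbot : pfun := fun _ => None.

Definition ple (p q : pfun) : Prop := forall x, p x <> None -> q x = p x.

Definition in_D (p : pfun) : Prop :=
  forall k, p k = Some true -> forall k', k <= k' -> p k' = Some true.

(* [F] acts on all partial functions because it does not preserve [in_D] when
   M halts: if M halts at step m and p is 0 exactly on {0, ..., m - 1}, then
   F p is 1 at m but undefined at m + 1. *)
Definition F (M : turing_machine) (w : seq (symbol M)) (p : pfun) : pfun :=
  fun n => match n with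
  | 0 => if halts_by w 0 then Some true else Some false
  | k.+1 =>
      match p k with
      | None => None
      | Some true => Some true
      | Some false => if halts_at w k.+1 then Some true else Some false
      end
  end.

Definition approx (M : turing_machine) (w : seq (symbol M)) (n : nat) : pfun :=
  iter n (F w) pbot.

(* Leastness is among all partial functions, hence also among those in [in_D]. *)
Definition is_lub (u : nat -> pfun) (p : pfun) : Prop :=
  (forall n, ple (u n) p) /\
  (forall q, (forall n, ple (u n) q) -> ple p q).

Definition is_lfp (G : pfun -> pfun) (p : pfun) : Prop :=
  G p = p /\ (forall q, G q = q -> ple p q).

Definition B (T : nat) (p : pfun) : Prop :=
  (forall k, k < T -> p k <> None) /\ (forall k, T <= k -> p k = None).

(* Main.v *)
Require Import Defs.
From mathcomp Require Import all_boot all_order all_algebra.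
From Stdlib Require Import FunctionalExtensionality.

(** The limit is the total function [k |-> "M halts by step k"]: the [n]-th
    iterate is its restriction to [{0, ..., n - 1}], and every fixed point of [F]
    agrees with it by induction on the argument.  Being total, it is undefined
    nowhere, hence lies in no [B_T]. *)

Definition halting_observation {M : turing_machine} (w : seq (symbol M)) : pfun :=
  fun k => Some (halts_by w k).

Lemma halts_byP {M : turing_machine} (w : seq (symbol M)) (k : nat) :
  reflect (exists2 j, j <= k & halts_at w j) (halts_by w k).
Proof.
apply: (iffP existsP) => [[j hj]|[j le_jk hj]].
  by exists (val j); first exact: (ltn_ord j).
by have lt_jk : j < k.+1 by []; exists (Ordinal lt_jk).
Qed.

Lemma halts_byS {M : turing_machine} (w : seq (symbol M)) (k : nat) :
  halts_by w k.+1 = halts_by w k || halts_at w k.+1.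
Proof.
apply/halts_byP/orP => [[j]|[/halts_byP[j le_jk hj]|hk]].
- rewrite leq_eqVlt => /orP[/eqP-> hj|lt_jk hj]; first by right.
  by left; apply/halts_byP; exists j.
- by exists j; rewrite // leqW.
- by exists k.+1.
Qed.

Lemma halts_by_le {M : turing_machine} (w : seq (symbol M)) (k k' : nat) :
  k <= k' -> halts_by w k -> halts_by w k'.
Proof.
move=> le_kk' /halts_byP[j le_jk hj]; apply/halts_byP.
by exists j; rewrite // (leq_trans le_jk).
Qed.

(** The clause of [F] at [k.+1] is the recursion [halts_byS]: a 1 persists, and a 0 becomes 1
    exactly when [M] halts at [k.+1]. *)
Lemma F_halting_observation {M : turing_machine} (w : seq (symbol M)) :
  F w (halting_observation w) = halting_observation w.
Proof.
apply: functional_extensionality => -[|k] /=; rewrite /halting_observation.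
  by case: (halts_by w 0).
by rewrite halts_byS; case: (halts_by w k); case: (halts_at w k.+1).
Qed.

Lemma approxE {M : turing_machine} (w : seq (symbol M)) (n k : nat) :
  approx w n k = if k < n then halting_observation w k else None.
Proof.
elim: n k => [//|n IHn] k; rewrite /approx iterS -/(approx w n).
(* Writing the limit as its own image under [F] lets both sides be compared clause by clause. *)
rewrite -F_halting_observation; case: k => [//|k] /=.
by rewrite IHn ltnS; case: (k < n).
Qed.

(** [F w q] ignores [q] at 0 and reads only [q k] at [k.+1], so the equation determines every value
    of [q]. *)
Lemma F_fixpoint_unique {M : turing_machine} (w : seq (symbol M)) (q : pfun) :
  F w q = q -> q =1 halting_observation w.
Proof.
move=> Fq; elim=> [|k IHk]; rewrite -Fq -F_halting_observation //=.
by rewrite IHk.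
Qed.

Theorem mainTheorem4 (M : turing_machine) (w : seq (symbol M)) :
  exists p_omega : pfun,
    in_D p_omega /\
    is_lub (approx w) p_omega /\
    is_lfp (F w) p_omega /\
    ~ (exists T : nat, B T p_omega).
Proof.
exists (halting_observation w); split; last split; last split.
- move=> k [hk] k' le_kk'.
  by rewrite /halting_observation (halts_by_le _ _ _ le_kk' hk).
- split=> [n k|q ub_q k _]; first by rewrite approxE; case: (k < n).
  (* Iterate [k.+1] is the first one defined at [k]; it forces the value of [q] there. *)
  by have := ub_q k.+1 k; rewrite approxE ltnSn; apply.
- split=> [|q /F_fixpoint_unique q_eq k _]; first exact: F_halting_observation.
  exact: q_eq.
- by case=> T [_ /(_ T (leqnn T))].
Qed.
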